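(* Let $\alpha\in[0,1/2]$, let $\mathcal{X}$ and $\mathcal{Y}$ be finite alphabets, let $P_{XY}$ be a joint distribution on $\mathcal{X}\times\mathcal{Y}$ with $X$-marginal $P_X$, and let $E\subseteq\mathcal{X}\times\mathcal{Y}$ be an event such that for all $y\in\mathcal{Y}$, $P_X(E_y)\le\alpha$, where $E_y:=\{x:(x,y)\in E\}$. Then $$P_{XY}(E)\le\alpha\big(2(1-\alpha)J_\infty(X;Y)+1\big),$$ where $$J_\infty(X;Y)=\frac12\sum_{y\in\mathcal{Y}}\Big(\max_{x:\,P_X(x)>0}P_{Y|X}(y|x)-\min_{x:\,P_X(x)>0}P_{Y|X}(y|x)\Big).$$
   Context: $P_{Y|X}(y|x)=P_{XY}(x,y)/P_X(x)$ for $P_X(x)>0$ is the conditional distribution of $Y$ given $X$. *)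

(* Defs.v *)
From mathcomp Require Import all_boot all_order all_algebra.
Set Implicit Arguments.
Unset Strict Implicit.
Unset Printing Implicit Defensive.
Import Order.TTheory GRing.Theory Num.Theory.
Local Open Scope ring_scope.

Definition is_distr (R : realFieldType) (T : finType) (P : T -> R) : Prop :=
  (forall t, 0 <= P t) /\ \sum_t P t = 1.

Definition Pr (R : realFieldType) (T : finType) (P : T -> R) (A : {set T}) : R :=
  \sum_(t in A) P t.

Definition marginalX (R : realFieldType) (X Y : finType) (P : X * Y -> R)
  (x : X) : R := \sum_y P (x, y).

(* P_{Y|X}(y|x); only meaningful where 0 < marginalX P x. *)
Definition condYX (R : realFieldType) (X Y : finType) (P : X * Y -> R)
  (y : Y) (x : X) : R := P (x, y) / marginalX P x.

(* The extrema range over the support of P_X, which is nonempty when P is a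
   distribution. As conditional probabilities lie in [0, 1], the default values
   0 and 1 of the iterated operators do not affect the results: see
   max_condYXP and min_condYXP below. *)
Definition max_condYX (R : realFieldType) (X Y : finType) (P : X * Y -> R)
  (y : Y) : R := \big[Num.max/0]_(x | 0 < marginalX P x) condYX P y x.

Definition min_condYX (R : realFieldType) (X Y : finType) (P : X * Y -> R)
  (y : Y) : R := \big[Num.min/1]_(x | 0 < marginalX P x) condYX P y x.

Definition J_infty (R : realFieldType) (X Y : finType) (P : X * Y -> R) : R :=
  2^-1 * \sum_y (max_condYX P y - min_condYX P y).

Definition sectionX (X Y : finType) (E : {set X * Y}) (y : Y) : {set X} :=
  [set x | (x, y) \in E].

Lemma supportX_nonempty (R : realFieldType) (X Y : finType) (P : X * Y -> R) :
  is_distr P -> exists x, 0 < marginalX P x.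
Proof.
move=> [P0 P1]; apply/existsP; apply: contraT => /existsPn H.
have : \sum_x marginalX P x = 0.
  apply: big1 => x _; apply/eqP; rewrite eq_le leNgt H /=.
  exact: sumr_ge0.
rewrite /marginalX pair_big /= => /eqP.
under eq_bigr => p _ do rewrite -surjective_pairing.
by rewrite P1 oner_eq0.
Qed.

Lemma condYX_bounds (R : realFieldType) (X Y : finType) (P : X * Y -> R) y x :
  is_distr P -> 0 < marginalX P x -> 0 <= condYX P y x <= 1.
Proof.
move=> [P0 _] mx; rewrite /condYX divr_ge0 ?(ltW mx) //= ler_pdivrMr // mul1r.
by rewrite /marginalX (bigD1 y) //= lerDl sumr_ge0.
Qed.

Lemma max_condYXP (R : realFieldType) (X Y : finType) (P : X * Y -> R) y :
  is_distr P ->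
  (exists2 x, 0 < marginalX P x & max_condYX P y = condYX P y x) /\
  (forall x, 0 < marginalX P x -> condYX P y x <= max_condYX P y).
Proof.
move=> dP; have [x0 mx0] := supportX_nonempty dP; split.
  rewrite /max_condYX (bigmax_eq_arg _ x0) //; last first.
    by move=> x /(condYX_bounds y dP) /andP[].
  by case: arg_maxP => // x mx _; exists x.
by move=> x mx; rewrite /max_condYX; apply: le_bigmax_cond.
Qed.

Lemma min_condYXP (R : realFieldType) (X Y : finType) (P : X * Y -> R) y :
  is_distr P ->
  (exists2 x, 0 < marginalX P x & min_condYX P y = condYX P y x) /\
  (forall x, 0 < marginalX P x -> min_condYX P y <= condYX P y x).
Proof.
move=> dP; have [x0 mx0] := supportX_nonempty dP; split.
  rewrite /min_condYX (bigmin_eq_arg _ x0) //; last first.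
    by move=> x /(condYX_bounds y dP) /andP[].
  by case: arg_minP => // x mx _; exists x.
by move=> x mx; rewrite /min_condYX; apply: bigmin_le_cond.
Qed.

(* Main.v *)
Require Import Defs.
From mathcomp Require Import all_boot all_order all_algebra.
From mathcomp Require Import lra.
Set Implicit Arguments.
Unset Strict Implicit.
Unset Printing Implicit Defensive.
Import Order.TTheory GRing.Theory Num.Theory.
Local Open Scope ring_scope.

(** Fix [y] and put [a = P_X(E_y)], [S = P_XY(E_y * {y})], [p = P_Y(y)], with
    [M] and [m] the extrema of [P_{Y|X}(y|.)]. Then [S <= M a] on [E_y] and
    [p - S >= m (1 - a)] off it; weighting these by [1 - a] and [a] gives
    [S <= a p + a (1 - a) (M - m)]. Since [a (1 - a)] increases on [[0, 1/2]],
    [a] may be replaced by [alpha], and summing over [y] concludes. *)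

(** Off the support of [P_X] all three terms vanish, so the bounds need no support condition and can
    be summed over any set of [x]. *)
Lemma joint_bounds (R : realFieldType) (X Y : finType) (P : X * Y -> R) x y :
  is_distr P ->
  min_condYX P y * marginalX P x <= P (x, y) <=
  max_condYX P y * marginalX P x.
Proof.
move=> dP; have [P0 _] := dP.
have [mx|mx] := ltP 0 (marginalX P x).
  apply/andP; split.
    by rewrite -ler_pdivlMr //; exact: (min_condYXP y dP).2.
  by rewrite -ler_pdivrMr //; exact: (max_condYXP y dP).2.
have mx0 : marginalX P x = 0 by apply/eqP; rewrite eq_le mx sumr_ge0.
have -> : P (x, y) = 0.
  apply/eqP; rewrite eq_le P0 andbT -mx0 /marginalX (bigD1 y) //= lerDl.
  exact: sumr_ge0.
by rewrite mx0 !mulr0 lexx.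
Qed.

Lemma min_le_max_condYX (R : realFieldType) (X Y : finType)
    (P : X * Y -> R) y :
  is_distr P -> min_condYX P y <= max_condYX P y.
Proof.
move=> dP; have [x mx] := supportX_nonempty dP.
exact: le_trans ((min_condYXP y dP).2 x mx) ((max_condYXP y dP).2 x mx).
Qed.

Lemma sum_marginalX (R : realFieldType) (X Y : finType) (P : X * Y -> R) :
  \sum_x marginalX P x = \sum_t P t.
Proof. by rewrite pair_big /=; apply: eq_bigr => -[]. Qed.

Lemma Pr_sections (R : realFieldType) (X Y : finType) (P : X * Y -> R)
    (E : {set X * Y}) :
  Pr P E = \sum_y \sum_(x in sectionX E y) P (x, y).
Proof.
(* Summation over [x] has to come first for the pairs to appear as [(x, y)]. *)
rewrite (exchange_big_dep xpredT) //= pair_big_dep /=.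
by apply: eq_big => -[x y] //=; rewrite inE.
Qed.

Lemma section_bound (R : realFieldType) (alpha : R) (X Y : finType)
    (P : X * Y -> R) (A : {set X}) (y : Y) :
  0 <= alpha <= 2^-1 -> is_distr P -> Pr (marginalX P) A <= alpha ->
  \sum_(x in A) P (x, y) <=
  alpha * \sum_x P (x, y) +
  alpha * (1 - alpha) * (max_condYX P y - min_condYX P y).
Proof.
move=> /andP[alpha0 alpha2] dP aalpha; have [P0 P1] := dP.
set M := max_condYX P y; set m := min_condYX P y.
set a := Pr _ A in aalpha; set S := \sum_(x in A) _.
set T := \sum_(x in ~: A) P (x, y).
have a0 : 0 <= a by apply: sumr_ge0 => x _; exact: sumr_ge0.
have setC (F : X -> R) :
    \sum_x F x = \sum_(x in A) F x + \sum_(x in ~: A) F x.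
  by rewrite (bigID [in A]) /=; congr (_ + _); apply: eq_bigl => x; rewrite inE.
have aC : Pr (marginalX P) (~: A) = 1 - a.
  by rewrite -P1 -sum_marginalX setC addrC addKr.
have SM : S <= M * a.
  rewrite mulr_sumr; apply: ler_sum => x _.
  by case/andP: (joint_bounds x y dP).
have mT : m * (1 - a) <= T.
  rewrite -aC mulr_sumr; apply: ler_sum => x _.
  by case/andP: (joint_bounds x y dP).
have p0 : 0 <= S + T by rewrite -setC; exact: sumr_ge0.
have mM : 0 <= M - m by rewrite subr_ge0 min_le_max_condYX.
rewrite setC -/S -/T.
have a1 : 0 <= 1 - a by lra.
(* Both [a] and [alpha] are at most 1/2. *)
have b1 : 0 <= 1 - alpha - a by lra.
have c0 : 0 <= alpha - a by lra.
have Sa : (1 - a) * S <= (1 - a) * (M * a) by exact: ler_wpM2l.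
have Ta : a * (m * (1 - a)) <= a * T by exact: ler_wpM2l.
have pa : 0 <= (alpha - a) * (S + T) by exact: mulr_ge0.
(* The first two factors multiply to [alpha * (1 - alpha) - a * (1 - a)], which gives the
   monotonicity. Then [Sa + Ta + pa + qa] is the goal. *)
have qa : 0 <= (alpha - a) * (1 - alpha - a) * (M - m) by rewrite !mulr_ge0.
lra.
Qed.

Theorem theorem3 (R : realFieldType) (alpha : R) (X Y : finType)
  (P : X * Y -> R) (E : {set X * Y})
  (halpha : 0 <= alpha <= 2^-1)
  (hP : is_distr P)
  (hE : forall y : Y, Pr (marginalX P) (sectionX E y) <= alpha) :
  Pr P E <= alpha * (2 * (1 - alpha) * J_infty P + 1).
Proof.
rewrite Pr_sections.
apply: le_trans (ler_sum _ (fun y _ => section_bound y halpha hP (hE y))) _.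
(* After the exchange, the [y]-marginals add up to the total mass 1, and the factor 2 in the goal
   cancels the 1/2 in [J_infty]. *)
rewrite big_split /= -!mulr_sumr exchange_big /=.
rewrite (sum_marginalX P) hP.2 /J_infty.
lra.
Qed.
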